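(* Let $c>0$, let $(m_n)_{n\ge 2}$ be a sequence of positive integers, write $m=m_n$ and $p=p_n:=n^{-2}$, and for each $n$ let $X=(X_{ij})_{1\le i,j\le n}$ be a random matrix with joint multinomial distribution $\mathcal{M}(m,n^2)$. Assume that $$\frac{mp}{\log n}\to c\quad\text{as } n\to\infty.$$ Then: (i) for every $c>0$, as $n\to\infty$, $$\mathbb{E}\max_{\sigma\in\mathcal{S}_n}\sum_{i=1}^n X_{i\sigma(i)}=c\,H_*\,n\log n\,(1+o(1)),$$ where $H_*=H_*(c)$ is the unique solution $H$ of $H\log H-(H-1)=\frac1c$ with $H>1$; (ii) for every $c>1$, as $n\to\infty$, $$\mathbb{E}\min_{\sigma\in\mathcal{S}_n}\sum_{i=1}^n X_{i\sigma(i)}=c\,\widetilde{H}_*\,n\log n\,(1+o(1)),$$ where $\widetilde{H}_*=\widetilde{H}_*(c)$ is the unique solution $H$ of $H\log H-(H-1)=\frac1c$ with $0<H<1$.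
   Context: $\mathcal{S}_n$ denotes the group of permutations of $\{1,\dots,n\}$. $\mathcal{M}(m,N)$ denotes the multinomial law with $m$ trials and $N$ equiprobable cells: it is the law of the vector of cell counts when $m$ particles are thrown independently and uniformly into $N$ cells. Under $\mathcal{M}(m,n^2)$ the cells are the $n^2$ positions $(i,j)$ of the matrix, so each $X_{ij}$ has the binomial distribution with $m$ trials and success probability $p=n^{-2}$, and $\sum_{i,j}X_{ij}=m$. *)

(* Defs.v *)
(* MathComp / MathComp-Analysis *)
From HB Require Import structures.
From mathcomp Require Import all_boot all_order all_algebra all_fingroup.
From mathcomp Require Import all_classical all_reals all_analysis.

Set Implicit Arguments.
Unset Strict Implicit.
Unset Printing Implicit Defensive.

Import Order.TTheory GRing.Theory Num.Theory.
Import numFieldNormedType.Exports.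

Local Open Scope classical_set_scope.
Local Open Scope ring_scope.

(* A throw of m particles is a map w : 'I_m -> C; independent and uniform
   throws make the #|C| ^ m maps equally likely. *)
Definition cell_count (C : finType) (m : nat) (w : {ffun 'I_m -> C}) (x : C)
    : nat :=
  #|[set i : 'I_m | w i == x]%SET|.

Definition multinomial_pmf (R : realType) (C : finType) (m : nat)
    (k : C -> nat) : R :=
  #|[set w : {ffun 'I_m -> C} | [forall x, cell_count w x == k x]]%SET|%:R
    / (#|C| ^ m)%:R.

Definition multinomial_matrix (R : realType) (d : measure_display)
    (T : measurableType d) (P : probability T R) (n m : nat)
    (X : T -> 'M[nat]_n) : Prop :=
  (forall i j, measurable_fun [set: T] (fun w => X w i j)) /\
  (forall k : 'M[nat]_n, P [set w | X w = k] =
     (multinomial_pmf R m (fun ij : 'I_n * 'I_n => k ij.1 ij.2))%:E).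

Definition assignment_cost (n : nat) (A : 'M[nat]_n) (s : 'S_n) : nat :=
  (\sum_(i < n) A i (s i))%N.

Definition max_assignment (n : nat) (A : 'M[nat]_n) : nat :=
  (\max_(s : 'S_n) assignment_cost A s)%N.

Definition min_assignment (n : nat) (A : 'M[nat]_n) : nat :=
  assignment_cost A [arg min_(s < (1%g : 'S_n)) assignment_cost A s]%N.

(* u_n = v_n (1 + o(1)) as n -> oo; in particular u_n is eventually finite. *)
Definition eq_1Do1 (R : realType) (u : nat -> \bar R) (v : nat -> R) : Prop :=
  exists2 e : nat -> R, e n @[n --> \oo] --> (0 : R) &
    \forall n \near \oo, u n = (v n * (1 + e n))%:E.

(* Main.v *)
Require Import Defs.
From mathcomp Require Import all_boot all_order all_algebra all_fingroup.
From mathcomp Require Import all_classical all_reals all_analysis.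
From mathcomp Require Import measurable_realfun.
From mathcomp Require Import ring lra.
Import Order.TTheory GRing.Theory Num.Theory.
Import numFieldNormedType.Exports.
Set Implicit Arguments.
Unset Strict Implicit.
Unset Printing Implicit Defensive.
Local Open Scope classical_set_scope.
Local Open Scope ring_scope.

(** Write mu = m / n^2 for the mean of an entry and L = ln n, so that mu / L tends
    to c. The matrix takes finitely many values almost surely, and an expectation
    is an average over the equally likely throws w ([expectation_multinomial]).

    An entry behaves like a Poisson variable of mean mu, and it is near h c L with
    probability n^(- c rate(h) + o(1)), where rate(h) = h ln h - (h - 1). The level
    H with c rate(H) = 1 is thus the one reached about once in a row of n entries.

    On average, no assignment goes much beyond that level. For a = ln h and
    t = h c L, every assignment satisfies
      a (cost - n t) <= sum over all i, j of exp (a (X_ij - t)),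
    because y <= exp y and the other terms are positive. By the exponential moment
    of the binomial law, the mean of the right-hand side is at most
    n^(2 - c rate(h) + o(1)), hence eventually at most n if c rate(h) > 1. The sign of a
    selects the direction: h > 1 bounds the maximum from above ([mean_max_le]) and
    h < 1 bounds the minimum from below ([mean_min_ge]).

    Conversely let c rate(h) < 1 and k = floor (h c L), and call (i, j) an edge when
    X_ij = k. If any eps n rows and eps n columns are joined by an edge, then some
    permutation uses edges in all but eps n of its rows ([near_perfect_matching]);
    its cost is n k up to the contribution of the exceptional rows, which is
    nonnegative for the maximum, and which for the minimum is controlled by the
    upper bound above applied to some large level. For two given sets of rows and
    columns, comparison with independent Poisson entries ([mean_throw_avoid_le])
    bounds the probability that no edge joins them by e m exp (- eps^2 n^2 q), where
    n q = n^(1 - c rate(h) + o(1)) tends to infinity by Stirling's formula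
    ([near_poisson_pmf_ge]). This beats the 4^n choices of the two sets
    ([cvg_mean_not_spread]).

    Letting h tend to H from both sides gives the two limits. *)

(** * The rate function and Stirling's bound *)

(** The Cramer rate function of the Poisson law of mean 1. *)
Definition rate (R : realType) (h : R) : R := h * ln h - (h - 1).

Lemma ln_le_subr1 (R : realType) (x : R) : 0 < x -> ln x <= x - 1.
Proof.
move=> x0; have := @le_ln1Dx R (x - 1).
by rewrite addrCA subrr addr0; apply; rewrite ltrBrDl subrr.
Qed.

Lemma ln_lt_subr1 (R : realType) (x : R) : 0 < x -> x != 1 -> ln x < x - 1.
Proof.
move=> x0 x1; have lx0 : ln x != 0 by rewrite ln_eq0.
by have := expR_gt1Dx lx0; rewrite lnK ?posrE// ltrBrDl.
Qed.

(** The logarithm is the derivative of [rate], so this is strict convexity; it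
    reduces to [ln x < x - 1] at [x = a / b]. *)
Lemma rate_gt_tangent (R : realType) (a b : R) :
  0 < a -> 0 < b -> a != b -> rate a + ln a * (b - a) < rate b.
Proof.
move=> a0 b0 ab.
have ab1 : a / b != 1.
  by apply: contra ab => /eqP e; rewrite -[a](divfK (lt0r_neq0 b0)) e mul1r.
have := ln_lt_subr1 (divr_gt0 a0 b0) ab1.
rewrite ln_div ?posrE// => H.
have : b * (ln a - ln b) < b * (a / b - 1) by rewrite ltr_pM2l.
rewrite mulrBr [b * (a / b - 1)]mulrBr mulrCA divff ?lt0r_neq0// !mulr1 /rate.
lra.
Qed.

Lemma rate_incr (R : realType) (a b : R) : 1 <= a -> a < b -> rate a < rate b.
Proof.
move=> a1 ab; have a0 : 0 < a by exact: lt_le_trans a1.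
apply: le_lt_trans (rate_gt_tangent a0 (lt_trans a0 ab) _); last by rewrite lt_eqF.
by rewrite lerDl mulr_ge0 ?ln_ge0// subr_ge0 ltW.
Qed.

Lemma rate_decr (R : realType) (a b : R) :
  0 < a -> a < b -> b <= 1 -> rate b < rate a.
Proof.
move=> a0 ab b1.
apply: le_lt_trans (rate_gt_tangent (lt_trans a0 ab) a0 _); last by rewrite gt_eqF.
by rewrite lerDl mulr_le0 ?ln_le0// subr_le0 ltW.
Qed.

Lemma rate1 (R : realType) : rate (1 : R) = 0.
Proof. by rewrite /rate ln1 mulr0 !subrr. Qed.

Lemma continuous_rate (R : realType) (a b : R) :
  0 < a -> {within `[a, b], continuous (@rate R)}.
Proof.
move=> a0; apply: continuous_in_subspaceT => x /set_mem /=.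
rewrite in_itv /= => /andP[ax _]; have x0 : 0 < x by exact: lt_le_trans ax.
apply: cvgB; last by apply: cvgB; [exact: cvg_id|exact: cvg_cst].
by apply: cvgM; [exact: cvg_id|exact: continuous_ln].
Qed.

Lemma rate_root_gt1 (R : realType) (y : R) : 0 < y ->
  exists2 H : R, 1 < H & rate H = y.
Proof.
move=> y0; pose b : R := expR (1 + y).
(* at exp (1 + y) the rate is b y + 1 *)
have b1 : 1 < b by rewrite expR_gt1; lra.
have fb : y <= rate b by rewrite /rate expRK -/b; nra.
have [] := @IVT R (@rate R) 1 b y (ltW b1) (continuous_rate (b:=b) ltr01).
  by rewrite rate1 ge_min le_max (ltW y0) fb orbT.
move=> H; rewrite in_itv /= => /andP[H1 _] fH; exists H => //.
rewrite lt_neqAle H1 andbT; apply/eqP => e.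
by move: fH y0; rewrite -e rate1 => <-; rewrite ltxx.
Qed.

Lemma rate_root_lt1 (R : realType) (y : R) : 0 < y -> y < 1 ->
  exists2 H : R, 0 < H < 1 & rate H = y.
Proof.
move=> y0 y1; pose s : R := (1 - y) / 4; pose a := s ^+ 2.
have s0 : 0 < s by rewrite divr_gt0// subr_gt0.
have s1 : s < 1 by rewrite /s; lra.
have a0 : 0 < a by rewrite exprn_gt0.
have a1 : a < 1 by rewrite /a; nra.
(* ln s >= 1 - 1/s bounds the rate at s^2 below by (1 - s)^2 >= 1 - 2 s >= y *)
have fa : y <= rate a.
  have := @ln_le_subr1 R s^-1; rewrite invr_gt0 lnV ?posrE// => /(_ s0) H.
  have : a * - ln s <= a * (s^-1 - 1) by rewrite ler_pM2l.
  have -> : a * (s^-1 - 1) = s - a by rewrite /a; field; rewrite lt0r_neq0.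
  rewrite /rate {2}/a lnXn// mulr2n.
  have -> : y = 1 - 4 * s by rewrite /s; field.
  by rewrite /a; nra.
have [] := @IVT R (@rate R) a 1 y (ltW a1) (continuous_rate (b:=1) a0).
  by rewrite rate1 ge_min le_max (ltW y0) fa orbT.
move=> H; rewrite in_itv /= => /andP[aH H1] fH; exists H => //.
rewrite (lt_le_trans a0 aH) lt_neqAle H1 andbT; apply/eqP => e.
by move: fH y0; rewrite e rate1 => <-; rewrite ltxx.
Qed.

(** Stirling's bound [k! <= e k (k / e)^k]. The lost factor, of order [sqrt k],
    is harmless next to the powers of [n] and the exponentials that it meets. *)
Lemma fact_le_stirling (R : realType) (k : nat) : (0 < k)%N ->
  k`!%:R <= expR (k%:R * ln k%:R - k%:R + ln k%:R + 1) :> R.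
Proof.
elim: k => // -[_ _|k IH _].
  by rewrite factS fact0 muln1 mulr1n ln1 mulr0 add0r addr0 addNr expR0.
have k0 : 0 < k.+1%:R :> R by rewrite ltr0n.
have k20 : 0 < k.+2%:R :> R by rewrite ltr0n.
rewrite factS natrM -{1}[X in X * _](lnK k20) //.
apply: (le_trans (ler_wpM2l (expR_ge0 _) (IH isT))).
rewrite -expRD ler_expR.
have := ln_le_subr1 (divr_gt0 k0 k20); rewrite ln_div ?posrE// => H.
have : k.+2%:R * (ln k.+1%:R - ln k.+2%:R) <= k.+2%:R * (k.+1%:R / k.+2%:R - 1) :> R.
  by rewrite ler_pM2l.
rewrite [leRHS]mulrBr mulrCA divff ?lt0r_neq0// !mulr1.
have -> : k.+2%:R = k.+1%:R + 1 :> R by rewrite natr1.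
by set u := k.+1%:R; lra.
Qed.

(** * Counting throws; near-perfect matchings *)

Lemma cell_countE (C : finType) (m : nat) (w : {ffun 'I_m -> C}) (x : C) :
  cell_count w x = (\sum_(i < m) (w i == x))%N.
Proof.
rewrite /cell_count -sum1_card big_mkcond /=.
by apply: eq_bigr => i _; rewrite inE; case: eqP.
Qed.

Lemma sum_cell_count (C : finType) (m : nat) (w : {ffun 'I_m -> C}) :
  (\sum_x cell_count w x = m)%N.
Proof.
under eq_bigr do rewrite cell_countE.
rewrite exchange_big /= -[RHS]card_ord -sum1_card; apply: eq_bigr => i _.
rewrite (bigD1 (w i)) //= eqxx big1 ?addn0// => x xw.
by rewrite eq_sym (negbTE xw).
Qed.

Lemma cell_count_le (C : finType) (m : nat) (w : {ffun 'I_m -> C}) (x : C) :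
  (cell_count w x <= m)%N.
Proof. by rewrite -[leqRHS](sum_cell_count w) (bigD1 x) //= leq_addr. Qed.

Definition tail_throw (C : finType) (m : nat) (w : {ffun 'I_m.+1 -> C}) :
  {ffun 'I_m -> C} := [ffun i => w (lift ord0 i)].

Lemma cell_count_recl (C : finType) (m : nat) (w : {ffun 'I_m.+1 -> C}) (x : C) :
  cell_count w x = ((w ord0 == x) + cell_count (tail_throw w) x)%N.
Proof.
rewrite !cell_countE big_ord_recl; congr addn.
by apply: eq_bigr => i _; rewrite ffunE.
Qed.

(** The multinomial coefficient. Removing the first particle, which lies in some
    cell [x], lowers [k x] by one, and the sum of the [k x] is the number of
    particles. *)
Lemma card_cell_count_le (C : finType) (m : nat) (k : C -> nat) :
  (#|[set w : {ffun 'I_m -> C} | [forall x, cell_count w x == k x]]%SET|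
     * \prod_x (k x)`! <= m`!)%N.
Proof.
elim: m k => [|m IH] k; set A := finset _.
  have [->|[w]] := set_0Vmem A; first by rewrite cards0.
  rewrite inE => /forallP wk.
  rewrite big1 ?muln1 => [|x _].
    by rewrite (leq_trans (max_card _))// card_ffun card_ord expn0.
  by rewrite -(eqP (wk x)) cell_countE big_ord0.
have [->|[w0]] := set_0Vmem A; first by rewrite cards0.
rewrite inE => /forallP w0k.
have sk : (\sum_x k x = m.+1)%N.
  by rewrite -[RHS](sum_cell_count w0); apply: eq_bigr => x _; rewrite (eqP (w0k x)).
rewrite -sum1_card (partition_big (fun w : {ffun 'I_m.+1 -> C} => w ord0) xpredT) //=.
have -> : (m.+1`! = (\sum_x k x) * m`!)%N by rewrite sk factS.
rewrite !big_distrl /=; apply: leq_sum => x _.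
have [kx0|kx] := posnP (k x).
  rewrite big_pred0 ?mul0n// => w; apply/negP => /andP[]; rewrite inE.
  move=> /forallP /(_ x); rewrite cell_count_recl kx0 => /eqP e /eqP wx.
  by rewrite wx eqxx in e.
pose k' y := (k y - (y == x))%N.
have -> : (\prod_y (k y)`! = k x * \prod_y (k' y)`!)%N.
  rewrite (bigD1 x) //= [in RHS](bigD1 x) //= mulnA; congr muln.
    by rewrite /k' eqxx subn1 -[in LHS](prednK kx) factS prednK.
  by apply: eq_bigr => y yx; rewrite /k' (negbTE yx) subn0.
rewrite mulnCA leq_pmul2l//; apply: leq_trans (IH k'); rewrite leq_mul2r.
apply/orP; right.
pose B := [set w : {ffun 'I_m.+1 -> C} | (w \in A) && (w ord0 == x)]%SET.
have -> : (\sum_(i in A | i ord0 == x) 1 = #|B|)%N.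
  by rewrite -sum1_card; apply: eq_bigl => w; rewrite [in RHS]inE.
have inj : {in B &, injective (@tail_throw C m)}.
  move=> u v; rewrite [u \in _]inE [v \in _]inE.
  move=> /andP[_ /eqP ux] /andP[_ /eqP vx] uv.
  apply/ffunP => i; have [j ->|->] := unliftP ord0 i; last by rewrite ux vx.
  by have /ffunP/(_ j) := uv; rewrite !ffunE.
rewrite -(card_in_imset inj) subset_leq_card//; apply/fintype.subsetP => v /imsetP[w].
rewrite !inE => /andP[/forallP wk /eqP wx] ->; apply/forallP => y.
by rewrite /k' -(eqP (wk y)) cell_count_recl wx [x == y]eq_sym addKn.
Qed.

(** If no two large sets are free of edges, a permutation with the largest number
    of edges leaves few vertices unmatched: exchanging two of the unmatched pairs
    along an edge would gain an edge. *)
Lemma near_perfect_matching (n : nat) (e : rel 'I_n) (r : nat) :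
  (forall A B : {set 'I_n}, (r <= #|A|)%N -> (r <= #|B|)%N ->
     exists i j, [/\ i \in A, j \in B & e i j]) ->
  exists s : 'S_n, (#|[set i | ~~ e i (s i)]%SET| < r)%N.
Proof.
move=> H.
case: (@arg_minnP _ (1%g : 'S_n) xpredT (fun s : 'S_n => #|[set i | ~~ e i (s i)]%SET|)) => //.
move=> s _ smin; exists s; rewrite ltnNge; apply/negP => rU.
set U := finset _ in rU.
have [||i [_ [iU /imsetP[i' i'U ->] eij]]] := H U [set s x | x in U]%SET => //.
  by rewrite card_imset//; exact: perm_inj.
have := smin (tperm i i' * s)%g isT; rewrite leqNgt => /negP; apply.
apply: proper_card; apply/properP; split.
  apply/fintype.subsetP => y; rewrite !inE permM.
  case: tpermP => [->||//].
    by rewrite eij.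
  by move=> -> _; move: i'U; rewrite inE.
by exists i => //; rewrite !inE permM tpermL eij.
Qed.

(** * Expectations as averages over throws *)

Definition mean_throw (R : realType) (C : finType) (m : nat)
  (g : {ffun 'I_m -> C} -> R) : R := (\sum_w g w) / (#|C| ^ m)%:R.

Definition count_matrix (n m : nat) (w : {ffun 'I_m -> 'I_n * 'I_n}) : 'M[nat]_n :=
  \matrix_(i, j) cell_count w (i, j).

(** There are countably many matrices of natural numbers, so measurability of the
    entries makes every set of matrices an event. *)
Lemma measurable_matrix_preimage (d : measure_display) (T : measurableType d)
    (n : nat) (X : T -> 'M[nat]_n) :
  (forall i j, measurable_fun [set: T] (fun w => X w i j)) ->
  forall Y : set 'M[nat]_n, measurable [set w | Y (X w)].
Proof.
move=> mX Y.
have mk k : measurable [set w | X w = k].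
  rewrite [X in _ X](_ : _ = \bigcap_(ij in [set: 'I_n * 'I_n])
    [set w | X w ij.1 ij.2 = k ij.1 ij.2]).
    apply: fin_bigcap_measurable => // ij _.
    by have := mX ij.1 ij.2 measurableT [set k ij.1 ij.2]; rewrite setTI; apply.
  apply/seteqP; split=> [w /= <- //|w H]; apply/matrixP => i j.
  exact: (H (i, j)).
rewrite [X in _ X](_ : _ = \bigcup_(k in [set: 'M[nat]_n])
    (if k \in Y then [set w | X w = k] else set0)).
  apply: countable_bigcupT_measurable => [|k]; first exact: countableP.
  by case: ifP.
apply/seteqP; split=> [w Yw|w [k _]]; first by exists (X w); rewrite ?ifT ?inE.
by case: ifPn => //; rewrite inE /= => Yk ->.
Qed.

(** The point probabilities of the matrices realized by some throw already sum to
    1, so the random matrix is almost surely one of these finitely many. *)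
Lemma expectation_multinomial (R : realType) (d : measure_display)
    (T : measurableType d) (P : probability T R) (n m : nat) (X : T -> 'M[nat]_n)
    (g : 'M[nat]_n -> R) :
  (0 < n)%N -> (forall k, 0 <= g k) -> multinomial_matrix P m X ->
  ('E_P[fun w => g (X w)] =
     (mean_throw (fun w : {ffun 'I_m -> 'I_n * 'I_n} => g (count_matrix w)))%:E)%E.
Proof.
move=> n0 g0 [mX PX].
have mY := measurable_matrix_preimage mX.
pose s := undup (codom (@count_matrix n m)).
have us : uniq s by exact: undup_uniq.
have sc w : @count_matrix n m w \in s by rewrite mem_undup codom_f.
pose h (f : 'M[nat]_n -> R) (x : T) : R := \sum_(k <- s) f k * \1_[set w | X w = k] x.
have hE f x : h f x = if X x \in s then f (X x) else 0.
  rewrite /h; case: ifPn => Xs.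
    rewrite (bigD1_seq (X x)) //= indicE mem_set// mulr1 big1 ?addr0// => k kX.
    by rewrite indicE memNset ?mulr0//= => e; rewrite -e eqxx in kX.
  rewrite big1_seq // => k /andP[_ ks]; rewrite indicE memNset ?mulr0//= => e.
  by move: Xs; rewrite e ks.
have Nm : ((#|{: 'I_n * 'I_n}| ^ m)%:R : R) != 0.
  by rewrite pnatr_eq0 expn_eq0 card_prod card_ord negb_and -lt0n muln_gt0 n0.
have int_h f : (forall k, 0 <= f k) -> (\int[P]_x (h f x)%:E =
    (mean_throw (fun w : {ffun 'I_m -> 'I_n * 'I_n} => f (count_matrix w)))%:E)%E.
  move=> f0.
  under eq_integral do rewrite /h -sumEFin.
  rewrite ge0_integral_sum//; last first.
  - by move=> k x _; rewrite lee_fin mulr_ge0.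
  - move=> k; apply/measurable_EFinP/measurable_funM => //.
    by apply: measurable_indic; exact: (mY [set k]).
  have int_k k : (\int[P]_x (f k * \1_[set w | X w = k] x)%:E =
      (f k * multinomial_pmf R m (fun ij : 'I_n * 'I_n => k ij.1 ij.2))%:E)%E.
    under eq_integral do rewrite EFinM.
    have m1 : measurable_fun [set: T] (EFin \o (\1_[set w | X w = k] : T -> R)).
      by apply/measurable_EFinP/measurable_indic; exact: (mY [set k]).
    rewrite ge0_integralZl_EFin// integral_indic// ?setIT.
      by rewrite EFinM; congr (_ * _)%E; exact: PX.
    exact: (mY [set k]).
  under eq_bigr do rewrite int_k.
  rewrite sumEFin; congr EFin; rewrite /mean_throw /multinomial_pmf.
  under eq_bigr do rewrite mulrA.
  rewrite -mulr_suml; congr (_ / _).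
  under [RHS]eq_bigr => w _.
    rewrite (_ : f _ = \sum_(k <- s) (count_matrix w == k)%:R * f k); last first.
      rewrite (bigD1_seq (count_matrix w)) //= eqxx mul1r big1 ?addr0// => k.
      by rewrite eq_sym => /negbTE ->; rewrite mul0r.
    over.
  rewrite exchange_big /=; apply: eq_bigr => k _.
  rewrite -mulr_suml mulrC; congr (_ * _).
  rewrite -sum1_card natr_sum big_mkcond /=; apply: eq_bigr => w _; rewrite inE.
  have -> : [forall x, cell_count w x == k x.1 x.2] = (count_matrix w == k).
    apply/forallP/eqP => [H|<- x]; last by rewrite mxE -surjective_pairing.
    by apply/matrixP => i j; rewrite mxE (eqP (H (i, j))).
  by case: eqP.
have mg : measurable_fun [set: T] (EFin \o (fun w => g (X w))).
  apply/measurable_EFinP => _ B mB; rewrite setTI.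
  exact: (mY [set k | B (g k)]).
have mh : measurable_fun [set: T] (EFin \o h g).
  have -> : EFin \o h g =
      EFin \o (fun w => (fun k => if k \in s then g k else 0) (X w)).
    by apply/funext => x /=; rewrite hE.
  apply/measurable_EFinP => _ B mB; rewrite setTI.
  exact: (mY [set k | B (if k \in s then g k else 0)]).
rewrite unlock -int_h//; apply: ae_eq_integral => //.
have ms : measurable [set w | X w \in s] by exact: (mY [set k | k \in s]).
have Ps : P [set w | X w \in s] = 1%E.
  have := int_h (fun=> 1) (fun=> ler01).
  rewrite /mean_throw sumr_const card_ffun card_ord divff// => <-.
  rewrite -[X in P X]setIT -integral_indic//; apply: eq_integral => x _.
  rewrite hE indicE; congr EFin.
  by case: ifPn => [H|/negP H]; [rewrite mem_set|rewrite memNset].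
exists (~` [set w | X w \in s]); split; first exact: measurableC.
  by apply: etrans (probability_setC P ms) _; rewrite Ps subee.
by move=> x /= H Xs; apply: H => _; rewrite /= hE Xs.
Qed.

(** * Comparison with Poisson variables *)

Lemma mean_throw_le (R : realType) (C : finType) (m : nat)
    (g h : {ffun 'I_m -> C} -> R) :
  (forall w, g w <= h w) -> mean_throw g <= mean_throw h.
Proof.
by move=> gh; rewrite /mean_throw ler_wpM2r ?invr_ge0 ?ler0n// ler_sum.
Qed.

Lemma mean_throwD (R : realType) (C : finType) (m : nat)
    (g h : {ffun 'I_m -> C} -> R) :
  mean_throw (fun w => g w + h w) = mean_throw g + mean_throw h.
Proof. by rewrite /mean_throw big_split mulrDl. Qed.

Lemma mean_throwZ (R : realType) (C : finType) (m : nat) (a : R)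
    (g : {ffun 'I_m -> C} -> R) :
  mean_throw (fun w => a * g w) = a * mean_throw g.
Proof. by rewrite /mean_throw -mulr_sumr mulrA. Qed.

Lemma mean_throw_sum (R : realType) (C I : finType) (m : nat)
    (g : I -> {ffun 'I_m -> C} -> R) :
  mean_throw (fun w => \sum_i g i w) = \sum_i mean_throw (g i).
Proof. by rewrite /mean_throw exchange_big -mulr_suml. Qed.

Lemma mean_throw_cst (R : realType) (C : finType) (m : nat) (a : R) :
  (0 < #|C|)%N -> mean_throw (fun _ : {ffun 'I_m -> C} => a) = a.
Proof.
move=> C0; rewrite /mean_throw sumr_const card_ffun card_ord -[a *+ _]mulr_natr mulfK//.
by rewrite pnatr_eq0 expn_eq0 negb_and -lt0n C0.
Qed.

(** The exponential moment of a binomial variable is at most that of the Poisson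
    variable of the same mean: it factors over the particles, and [1 + x <= exp x]
    bounds each factor. *)
Lemma mean_throw_expR_le (R : realType) (C : finType) (m : nat) (a : R) (x : C) :
  mean_throw (fun w : {ffun 'I_m -> C} => expR (a * (cell_count w x)%:R))
    <= expR (m%:R / #|C|%:R * (expR a - 1)).
Proof.
have C0 : 0 < #|C|%:R :> R by rewrite ltr0n; apply/card_gt0P; exists x.
have -> : mean_throw (fun w : {ffun 'I_m -> C} => expR (a * (cell_count w x)%:R))
    = ((#|C|%:R + (expR a - 1)) / #|C|%:R) ^+ m.
  rewrite /mean_throw natrX expr_div_n; congr (_ / _).
  under eq_bigr => w _ do rewrite cell_countE natr_sum mulr_sumr expR_sum.
  pose F (i : 'I_m) (y : C) : R := expR (a * (y == x)%:R).
  rewrite -(bigA_distr_bigA F) /F prodr_const card_ord; congr (_ ^+ _).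
  rewrite (bigD1 x) //= eqxx mulr1 (eq_bigr (fun=> 1)) => [|y /negbTE ->].
    rewrite sumr_const cardC1 -subn1 natrB; first by ring.
    by rewrite -(ltr0n R).
  by rewrite mulr0 expR0.
rewrite -mulrA expRM_natl; apply: lerXn2r; rewrite ?nnegrE ?expR_ge0//.
  rewrite divr_ge0 ?ler0n// addrCA addr_ge0 ?expR_ge0// subr_ge0.
  by rewrite (ler_nat R 1) -(ltr0n R).
rewrite mulrDl divff ?lt0r_neq0// mulrC; exact: expR_ge1Dx.
Qed.

Lemma sum_poisson_pmf_le1 (R : realType) (mu : R) (M : nat) : 0 < mu ->
  \sum_(j < M) poisson_pmf mu j <= 1.
Proof.
move=> mu0; under eq_bigr do rewrite /poisson_pmf mu0.
rewrite -mulr_suml expRN ler_pdivrMr ?expR_gt0// mul1r.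
have := @nondecreasing_cvgn_le R (series (exp_coeff mu)) _ (is_cvg_series_exp_coeff mu) M.
rewrite /series /= big_mkord; apply.
apply: nondecreasing_series => i _ _; exact/exp_coeff_ge0/ltW.
Qed.

(** The finite sum and the missing term are both part of a longer partial sum of
    the Poisson weights, so [k] may be smaller or larger than [M]. *)
Lemma sum_poisson_pmf_neq_le (R : realType) (mu : R) (M k : nat) : 0 < mu ->
  \sum_(j < M) (j != k :> nat)%:R * poisson_pmf mu j <= 1 - poisson_pmf mu k.
Proof.
move=> mu0; rewrite lerBrDr.
apply: le_trans (sum_poisson_pmf_le1 (maxn M k.+1) mu0).
have kM : (k < maxn M k.+1)%N by rewrite leq_max leqnn orbT.
rewrite [leRHS](bigD1 (Ordinal kM)) //= [leRHS]addrC lerD2r.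
rewrite (big_ord_widen _ (fun j => (j != k)%:R * poisson_pmf mu j) (leq_maxl M k.+1)).
rewrite big_mkcond [leRHS]big_mkcond /=; apply: ler_sum => j _.
rewrite -[j != Ordinal kM]/((j : nat) != k).
by case: (_ != k); case: ifP => _ //; rewrite ?mul1r ?mul0r ?poisson_pmf_ge0.
Qed.

(** Conditioned on their sum being [m], independent Poisson variables of mean
    [m / #|C|] have the law of the cell counts, and the conditioning event has
    probability at least [1 / (e m)] by Stirling's bound. *)
Lemma mean_throw_avoid_le (R : realType) (C : finType) (m : nat)
    (S : {set C}) (k : nat) : (0 < m)%N ->
  mean_throw (fun w : {ffun 'I_m -> C} =>
      [forall x in S, cell_count w x != k]%:R : R)
    <= expR 1 * m%:R * expR (- (#|S|%:R * poisson_pmf (m%:R / #|C|%:R) k)).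
Proof.
move=> m0; have [C0|C0] := posnP #|C|.
  rewrite /mean_throw big1 ?mul0r ?mulr_ge0 ?expR_ge0// => w _.
  by have := max_card (pred1 (w (Ordinal m0))); rewrite C0 card1.
set mu := m%:R / _.
have mR : 0 < m%:R :> R by rewrite ltr0n.
have CR : 0 < #|C|%:R :> R by rewrite ltr0n.
have mu0 : 0 < mu by rewrite divr_gt0.
pose p (w : {ffun 'I_m -> C}) : {ffun C -> 'I_m.+1} := [ffun x => inord (cell_count w x)].
have pE w x : p w x = cell_count w x :> nat.
  by rewrite ffunE inordK// ltnS cell_count_le.
have sum_p w : (\sum_x p w x = m)%N.
  by rewrite -[RHS](sum_cell_count w); apply: eq_bigr => x _; rewrite pE.
pose ok (f : {ffun C -> 'I_m.+1}) : R := \prod_x ((x \in S) ==> (f x != k :> nat))%:R.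
have okE w : [forall x in S, cell_count w x != k]%:R = ok (p w).
  rewrite /ok; case: forallP => [H|H].
    by rewrite big1// => x _; rewrite pE H.
  have /existsP[x /negbTE Hx] : [exists x, ~~ ((x \in S) ==> (cell_count w x != k))].
    by rewrite -negb_forall; apply/negP => /forallP.
  by rewrite (bigD1 x) //= pE Hx mul0r.
have ok0 f : 0 <= ok f by apply: prodr_ge0 => x _.
have q0 j : 0 <= poisson_pmf mu j by exact: poisson_pmf_ge0.
(* one composition at a time, the law of the counts against the Poisson law *)
have law f : (#|[set w | p w == f]%SET|)%:R / (#|C| ^ m)%:R
    <= expR 1 * m%:R * \prod_x poisson_pmf mu (f x).
  have [->|[w0]] := set_0Vmem [set w | p w == f]%SET.
    by rewrite cards0 mul0r mulr_ge0 ?prodr_ge0// mulr_ge0// expR_ge0.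
  rewrite inE => /eqP w0f; have sf : (\sum_x f x = m)%N by rewrite -w0f.
  have Pf0 : 0 < \prod_x ((f x)`!)%:R :> R.
    by apply: prodr_gt0 => x _; rewrite ltr0n fact_gt0.
  have -> : \prod_x poisson_pmf mu (f x)
      = mu ^+ m * expR (- m%:R) / \prod_x ((f x)`!)%:R.
    under eq_bigr do rewrite /poisson_pmf mu0.
    rewrite big_split big_split /= prodrXr sf prodfV prodr_const.
    rewrite -expRM_natl mulrN /mu mulrCA divff ?lt0r_neq0// mulr1.
    by rewrite mulrAC.
  rewrite mulrA ler_pdivlMr// mulrAC ler_pdivrMr; last by rewrite ltr0n expn_gt0 C0.
  apply: (@le_trans _ _ (m`!%:R)).
    have := card_cell_count_le m (fun x => f x : nat).
    rewrite -(ler_nat R) natrM natr_prod; apply: le_trans.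
    apply: ler_wpM2r; [exact: ltW|rewrite ler_nat subset_leq_card//].
    apply/fintype.subsetP => w; rewrite !inE => /eqP <-.
    by apply/forallP => x; rewrite pE.
  have -> : expR 1 * m%:R * (mu ^+ m * expR (- m%:R)) * (#|C| ^ m)%:R
      = expR (m%:R * ln m%:R - m%:R + ln m%:R + 1) :> R.
    rewrite !expRD expRM_natl !lnK// natrX /mu expr_div_n.
    by field; rewrite expf_neq0// lt0r_neq0.
  exact: fact_le_stirling.
rewrite /mean_throw (partition_big p xpredT) //= mulr_suml.
apply: (@le_trans _ _ (\sum_f ok f * (expR 1 * m%:R * \prod_x poisson_pmf mu (f x)))).
  apply: ler_sum => f _; rewrite (eq_bigr (fun=> ok f)); last first.
    by move=> w /eqP <-; rewrite okE.
  rewrite sumr_const -[ok f *+ _]mulr_natr -mulrA ler_wpM2l//.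
  by apply: le_trans (law f); rewrite cardsE.
under eq_bigr do rewrite mulrCA; rewrite -mulr_sumr ler_wpM2l//.
under eq_bigr do rewrite -big_split /=.
pose F (x : C) (j : 'I_m.+1) : R := ((x \in S) ==> (j != k :> nat))%:R * poisson_pmf mu j.
rewrite -(bigA_distr_bigA F).
apply: (@le_trans _ _ (\prod_(x in S) expR (- poisson_pmf mu k))); last first.
  by rewrite prodr_const -expRM_natl mulrN.
rewrite [leRHS]big_mkcond /=; apply: ler_prod => x _; apply/andP; split.
  by apply: sumr_ge0 => j _; rewrite mulr_ge0.
case: ifPn => xS; rewrite /F.
  under eq_bigr do rewrite xS /=.
  by apply: le_trans (sum_poisson_pmf_neq_le _ _ mu0) (expR_ge1Dx _).
under eq_bigr do rewrite (negbTE xS) mul1r.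
exact: sum_poisson_pmf_le1.
Qed.

(** * Spread of a level and deterministic bounds on assignments *)

(** For the graph whose edges are the cells with count [k]: any two sets of at
    least [r] rows and [r] columns are joined by an edge. *)
Definition spread (n m k r : nat) (w : {ffun 'I_m -> 'I_n * 'I_n}) : bool :=
  [forall A : {set 'I_n}, forall B : {set 'I_n},
     (r <= #|A|)%N ==> (r <= #|B|)%N ==>
     [exists i in A, exists j in B, cell_count w (i, j) == k]].

(** The union bound over the [4 ^ n] pairs of a set of rows and a set of columns. *)
Lemma mean_not_spread_le (R : realType) (n m k r : nat) : (0 < m)%N ->
  mean_throw (fun w : {ffun 'I_m -> 'I_n * 'I_n} => (~~ spread k r w)%:R : R)
    <= 4 ^+ n * (expR 1 * m%:R *
         expR (- (r%:R ^+ 2 * poisson_pmf (m%:R / n%:R ^+ 2) k))).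
Proof.
move=> m0; set bound := _ * expR _.
have b0 : 0 <= bound by rewrite mulr_ge0 ?mulr_ge0 ?expR_ge0.
pose g (AB : {set 'I_n} * {set 'I_n}) (w : {ffun 'I_m -> 'I_n * 'I_n}) : R :=
  [&& (r <= #|AB.1|)%N, (r <= #|AB.2|)%N &
     [forall x in finset.setX AB.1 AB.2, cell_count w x != k]]%:R.
apply: (@le_trans _ _ (mean_throw (fun w => \sum_AB g AB w))).
  apply: mean_throw_le => w; case: (boolP (spread k r w)) => [_|].
    by apply: sumr_ge0 => AB _; rewrite ler0n.
  rewrite negb_forall => /existsP[A]; rewrite negb_forall => /existsP[B].
  rewrite negb_imply negb_imply => /and3P[rA rB H].
  have av : [forall x in finset.setX A B, cell_count w x != k].
    apply/forallP => -[i j]; apply/implyP; rewrite finset.in_setX => /andP[iA jB].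
    apply: contra H => e; apply/existsP; exists i; rewrite iA /=.
    by apply/existsP; exists j; rewrite jB.
  by rewrite (bigD1 (A, B)) //= /g /= rA rB av lerDl sumr_ge0.
rewrite mean_throw_sum.
have -> : 4 ^+ n * bound = \sum_(AB : {set 'I_n} * {set 'I_n}) bound.
  have c2 : #|{set 'I_n}| = (2 ^ n)%N.
    by rewrite -[LHS]cardsT -powersetT card_powerset cardsT card_ord.
  rewrite sumr_const card_prod c2 -[bound *+ _]mulr_natr mulrC.
  by rewrite -expnMn natrX.
apply: ler_sum => -[A B] _; rewrite /g /=.
have [rA|_] := leqP r #|A|; last first.
  by rewrite /mean_throw big1 ?mul0r.
have [rB|_] := leqP r #|B|; last first.
  by rewrite /mean_throw big1 ?mul0r.
apply: le_trans (mean_throw_avoid_le _ _ _ m0) _.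
rewrite card_prod card_ord natrM -expr2 ler_wpM2l ?mulr_ge0 ?expR_ge0//.
rewrite ler_expR lerN2 ler_wpM2r ?poisson_pmf_ge0//.
by rewrite cardsX natrM expr2 ler_pM ?ler0n ?ler_nat.
Qed.

Lemma spread_near_matching (n m k r : nat) (w : {ffun 'I_m -> 'I_n * 'I_n}) :
  spread k r.+1 w ->
  exists s : 'S_n, (#|[set i | count_matrix w i (s i) != k]%SET| <= r)%N.
Proof.
move=> /forallP H; have [|s sr] := @near_perfect_matching n
  (fun i j => count_matrix w i j == k) r.+1; last by exists s.
move=> A B rA rB; have /forallP/(_ B) := H A; rewrite rA rB /=.
case/existsP => i /andP[iA /existsP[j /andP[jB e]]].
by exists i, j; rewrite mxE.
Qed.

Lemma max_assignmentP (n : nat) (A : 'M[nat]_n) :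
  exists s, max_assignment A = assignment_cost A s.
Proof.
have [|s H] := @bigop.eq_bigmax 'S_n (assignment_cost A); last by exists s.
by apply/card_gt0P; exists 1%g.
Qed.

Lemma le_max_assignment (n : nat) (A : 'M[nat]_n) (s : 'S_n) :
  (assignment_cost A s <= max_assignment A)%N.
Proof. exact: bigop.leq_bigmax. Qed.

Lemma min_assignmentP (n : nat) (A : 'M[nat]_n) :
  exists s, min_assignment A = assignment_cost A s.
Proof. by eexists. Qed.

Lemma min_assignment_le (n : nat) (A : 'M[nat]_n) (s : 'S_n) :
  (min_assignment A <= assignment_cost A s)%N.
Proof. by rewrite /min_assignment; case: arg_minnP => // s' _; apply. Qed.

(** Summed over all entries, this bounds all assignments at once. *)
Definition expo_sum (R : realType) (n : nat) (a t : R) (A : 'M[nat]_n) : R :=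
  \sum_(ij : 'I_n * 'I_n) expR (a * ((A ij.1 ij.2)%:R - t)).

(** From [y <= exp y]; the entries that the permutation does not use only add
    positive terms. *)
Lemma sum_entries_expo (R : realType) (n : nat) (a t : R) (A : 'M[nat]_n)
    (s : 'S_n) (U : {set 'I_n}) :
  \sum_(i in U) a * ((A i (s i))%:R - t) <= expo_sum a t A.
Proof.
rewrite /expo_sum -(pair_bigA _ (fun i j => expR (a * ((A i j)%:R - t)))) /=.
rewrite big_mkcond; apply: ler_sum => i _; case: ifP => _; last first.
  by apply: sumr_ge0 => j _; exact: expR_ge0.
rewrite (bigD1 (s i)) //= ler_wpDr//.
  by apply: sumr_ge0 => j _; exact: expR_ge0.
by apply: le_trans (expR_ge1Dx _); rewrite lerDr.
Qed.

Lemma assignment_cost_expo (R : realType) (n : nat) (a t : R) (A : 'M[nat]_n)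
    (s : 'S_n) :
  a * ((assignment_cost A s)%:R - n%:R * t) <= expo_sum a t A.
Proof.
apply: le_trans (sum_entries_expo a t A s [set: 'I_n]%SET).
rewrite -mulr_sumr natr_sum [in leRHS](eq_bigl xpredT); last by move=> i; rewrite finset.in_setT.
by rewrite sumrB sumr_const card_ord mulr_natl.
Qed.

Lemma assignment_cost_ge (R : realType) (n k u : nat) (A : 'M[nat]_n) (s : 'S_n) :
  (#|[set i | A i (s i) != k]%SET| <= u)%N ->
  (n%:R - u%:R) * k%:R <= (assignment_cost A s)%:R :> R.
Proof.
set U := finset _ => Uu; have nU : (n = #|U| + #|~: U|)%N by rewrite cardsC card_ord.
apply: (@le_trans _ _ (#|~: U|%:R * k%:R)).
  by rewrite ler_wpM2r// {1}nU natrD lerBlDr addrC lerD2l ler_nat.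
rewrite -natrM ler_nat /assignment_cost (bigID (mem U)) /=.
rewrite (@leq_trans (\sum_(i | i \notin U) k)%N)//.
  rewrite sum_nat_const leq_mul2r; apply/orP; right; apply: eq_leq.
  by apply: eq_card => i; rewrite finset.in_setC.
rewrite -[leqLHS]add0n leq_add// leq_sum// => i; rewrite /U inE negbK => /eqP ->.
exact: leqnn.
Qed.

(** Rows off the level [k] cost at most [t] each, up to excesses over [t] that the
    exponential sum controls. *)
Lemma assignment_cost_le (R : realType) (n k u : nat) (a t : R) (A : 'M[nat]_n)
    (s : 'S_n) :
  0 < a -> 0 <= t -> (#|[set i | A i (s i) != k]%SET| <= u)%N ->
  (assignment_cost A s)%:R <= n%:R * k%:R + u%:R * t + a^-1 * expo_sum a t A.
Proof.
set U := finset _ => a0 t0 Uu.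
rewrite natr_sum (bigID (mem U)) /= addrC -addrA lerD//.
  rewrite (eq_bigr (fun=> k%:R)); last by move=> i; rewrite /U inE negbK => /eqP ->.
  rewrite sumr_const -[_ *+ #|_|]mulr_natl ler_wpM2r// ler_nat.
  by rewrite -[leqRHS]card_ord max_card.
apply: (@le_trans _ _ (#|U|%:R * t + a^-1 * expo_sum a t A)); last first.
  by rewrite lerD2r ler_wpM2r// ler_nat.
rewrite -lerBlDl ler_pdivlMl//; apply: le_trans (sum_entries_expo a t A s U).
by rewrite -mulr_sumr sumrB sumr_const mulr_natl.
Qed.

Lemma mean_expo_sum_le (R : realType) (n m : nat) (a t : R) :
  mean_throw (fun w : {ffun 'I_m -> 'I_n * 'I_n} => expo_sum a t (count_matrix w))
    <= n%:R ^+ 2 * expR (m%:R / n%:R ^+ 2 * (expR a - 1) - a * t).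
Proof.
rewrite /expo_sum mean_throw_sum.
have -> : n%:R ^+ 2 * expR (m%:R / n%:R ^+ 2 * (expR a - 1) - a * t)
   = \sum_(ij : 'I_n * 'I_n) expR (- (a * t)) * expR (m%:R / n%:R ^+ 2 * (expR a - 1)).
  by rewrite sumr_const card_prod card_ord addrC expRD -[RHS]mulr_natl natrM expr2.
apply: ler_sum => -[i j] _.
have -> : (fun w : {ffun 'I_m -> 'I_n * 'I_n} =>
      expR (a * ((count_matrix w (i, j).1 (i, j).2)%:R - t)))
    = (fun w => expR (- (a * t)) * expR (a * (cell_count w (i, j))%:R)).
  by apply/funext => w /=; rewrite mxE -expRD mulrBr addrC.
rewrite mean_throwZ ler_wpM2l ?expR_ge0//.
by have := mean_throw_expR_le m a (i, j); rewrite card_prod card_ord natrM -expr2.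
Qed.

(** * Bounds on the mean optimal assignments *)

Lemma mean_max_le (R : realType) (n m : nat) (a t : R) : (0 < n)%N -> 0 < a ->
  mean_throw (fun w : {ffun 'I_m -> 'I_n * 'I_n} => (max_assignment (count_matrix w))%:R)
    <= n%:R * t + a^-1 * (n%:R ^+ 2 * expR (m%:R / n%:R ^+ 2 * (expR a - 1) - a * t)).
Proof.
move=> n0 a0; have ai0 : 0 <= a^-1 by rewrite invr_ge0 ltW.
apply: (@le_trans _ _ (mean_throw (fun w : {ffun 'I_m -> 'I_n * 'I_n} =>
  n%:R * t + a^-1 * expo_sum a t (count_matrix w)))).
  apply: mean_throw_le => w; have [s ->] := max_assignmentP (count_matrix w).
  rewrite -lerBlDl ler_pdivlMl//; exact: assignment_cost_expo.
rewrite mean_throwD mean_throw_cst ?mean_throwZ; last by rewrite card_prod card_ord muln_gt0 n0.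
by rewrite lerD2l ler_wpM2l// mean_expo_sum_le.
Qed.

Lemma mean_min_ge (R : realType) (n m : nat) (a t : R) : (0 < n)%N -> a < 0 ->
  n%:R * t + a^-1 * (n%:R ^+ 2 * expR (m%:R / n%:R ^+ 2 * (expR a - 1) - a * t)) <=
  mean_throw (fun w : {ffun 'I_m -> 'I_n * 'I_n} => (min_assignment (count_matrix w))%:R).
Proof.
move=> n0 a0; have ai0 : a^-1 <= 0 by rewrite invr_le0 ltW.
apply: (@le_trans _ _ (mean_throw (fun w : {ffun 'I_m -> 'I_n * 'I_n} =>
  n%:R * t + a^-1 * expo_sum a t (count_matrix w)))); last first.
  apply: mean_throw_le => w; have [s ->] := min_assignmentP (count_matrix w).
  rewrite -lerBrDl ler_ndivrMl//; exact: assignment_cost_expo.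
rewrite mean_throwD mean_throw_cst ?mean_throwZ; last by rewrite card_prod card_ord muln_gt0 n0.
by rewrite lerD2l ler_wnM2l// mean_expo_sum_le.
Qed.

Lemma mean_max_ge (R : realType) (n m k u : nat) : (0 < n)%N -> (u <= n)%N ->
  (n%:R - u%:R) * k%:R *
    (1 - mean_throw (fun w : {ffun 'I_m -> 'I_n * 'I_n} => (~~ spread k u.+1 w)%:R : R)) <=
  mean_throw (fun w : {ffun 'I_m -> 'I_n * 'I_n} => (max_assignment (count_matrix w))%:R).
Proof.
move=> n0 un; pose v : R := (n%:R - u%:R) * k%:R.
have v0 : 0 <= v by rewrite mulr_ge0// subr_ge0 ler_nat.
apply: (@le_trans _ _ (mean_throw (fun w : {ffun 'I_m -> 'I_n * 'I_n} =>
  v + (- v) * (~~ spread k u.+1 w)%:R))).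
  rewrite mean_throwD mean_throw_cst ?mean_throwZ; last by rewrite card_prod card_ord muln_gt0 n0.
  by rewrite -/v mulrBr mulr1 mulNr.
apply: mean_throw_le => w; case: (boolP (spread k u.+1 w)) => [|_] /=.
  move=> /spread_near_matching[s su]; rewrite mulr0 addr0.
  by apply: le_trans (assignment_cost_ge _ su) _; rewrite ler_nat le_max_assignment.
by rewrite mulr1 subrr.
Qed.

(** When the spread property fails, the identity permutation costs at most [n t] up
    to the exponential sum; this accounts for the third term. *)
Lemma mean_min_le (R : realType) (n m k u : nat) (a t : R) :
  (0 < n)%N -> 0 < a -> 0 <= t ->
  mean_throw (fun w : {ffun 'I_m -> 'I_n * 'I_n} => (min_assignment (count_matrix w))%:R) <=
  n%:R * k%:R + u%:R * t
  + n%:R * t * mean_throw (fun w : {ffun 'I_m -> 'I_n * 'I_n} => (~~ spread k u.+1 w)%:R)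
  + a^-1 * (n%:R ^+ 2 * expR (m%:R / n%:R ^+ 2 * (expR a - 1) - a * t)).
Proof.
move=> n0 a0 t0; have ai0 : 0 <= a^-1 by rewrite invr_ge0 ltW.
apply: (@le_trans _ _ (mean_throw (fun w : {ffun 'I_m -> 'I_n * 'I_n} =>
  (n%:R * k%:R + u%:R * t + n%:R * t * (~~ spread k u.+1 w)%:R)
  + a^-1 * expo_sum a t (count_matrix w)))); last first.
  rewrite 2!mean_throwD mean_throw_cst ?mean_throwZ; last first.
    by rewrite card_prod card_ord muln_gt0 n0.
  by rewrite lerD2l ler_wpM2l// mean_expo_sum_le.
apply: mean_throw_le => w; case: (boolP (spread k u.+1 w)) => [|_] /=.
  move=> /spread_near_matching[s su]; rewrite mulr0 addr0.
  apply: le_trans (assignment_cost_le a0 t0 su).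
  by rewrite ler_nat min_assignment_le.
apply: (@le_trans _ _ (assignment_cost (count_matrix w) 1%g)%:R).
  by rewrite ler_nat min_assignment_le.
rewrite mulr1 -!addrA ler_wpDl ?mulr_ge0// ler_wpDl ?mulr_ge0//.
by rewrite -lerBlDl ler_pdivlMl// assignment_cost_expo.
Qed.

(** * Asymptotics of the entries *)

Lemma near_ln_ge (R : realType) (A : R) : \forall n \near \oo, A <= ln (n%:R : R).
Proof.
near=> n; rewrite -[leLHS]expRK ler_ln ?posrE ?expR_gt0//.
  near: n; exact: nbhs_infty_ger.
by rewrite ltr0n; near: n; exact: nbhs_infty_ge.
Unshelve. all: by end_near. Qed.

Lemma cvg_inv_ln (R : realType) : (ln (n%:R : R))^-1 @[n --> \oo] --> (0 : R).
Proof.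
apply/cvgrPdist_le => e e0; near=> n.
have L : e^-1 <= ln (n%:R : R) by near: n; exact: near_ln_ge.
have L0 : 0 < ln (n%:R : R) by apply: lt_le_trans L; rewrite invr_gt0.
rewrite sub0r normrN ger0_norm; last by rewrite invr_ge0 ltW.
by rewrite -[leRHS]invrK lef_pV2 ?posrE ?invr_gt0.
Unshelve. all: by end_near. Qed.

(** The logarithm of the left-hand side is
    [L (2 - c rate h + o(1))] with [L = ln n]. *)
Lemma near_expo_le (R : realType) (c : R) (m : nat -> nat) (h : R) :
  0 < h -> 1 < c * rate h ->
  (m n)%:R * n%:R ^- 2 / ln (n%:R : R) @[n --> \oo] --> c ->
  \forall n \near \oo, n%:R ^+ 2 * expR ((m n)%:R / n%:R ^+ 2 * (expR (ln h) - 1)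
    - ln h * (h * c * ln n%:R)) <= n%:R :> R.
Proof.
move=> h0 ch m_lim; rewrite lnK ?posrE//.
have lim : 1 + (m n)%:R * n%:R ^- 2 / ln (n%:R : R) * (h - 1) - ln h * (h * c)
    @[n --> \oo] --> 1 + c * (h - 1) - ln h * (h * c).
  apply: cvgB; last exact: cvg_cst.
  apply: cvgD; first exact: cvg_cst.
  by apply: cvgM => //; exact: cvg_cst.
have neg : 1 + c * (h - 1) - ln h * (h * c) < 0 by move: ch; rewrite /rate; lra.
near=> n.
have n0 : 0 < n%:R :> R by rewrite ltr0n; near: n; exact: nbhs_infty_ge.
have L0 : 0 < ln (n%:R : R).
  by apply: (@lt_le_trans _ _ 1) => //; near: n; exact: near_ln_ge.
have bracket : 1 + (m n)%:R * n%:R ^- 2 / ln n%:R * (h - 1) - ln h * (h * c) <= 0 :> R.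
  by near: n; exact: cvgr_le lim _ neg.
have nE : n%:R = expR (ln n%:R) :> R by rewrite lnK.
rewrite [X in X ^+ 2 * _]nE [leRHS]nE.
rewrite -expRM_natl -expRD ler_expR.
have := ler_wpM2r (ltW L0) bracket; rewrite mul0r -subr_ge0 => H.
rewrite -subr_ge0; move: H; congr (0 <= _).
by field; rewrite !lt0r_neq0.
Unshelve. all: by end_near. Qed.

Lemma cvg_trunc_ln (R : realType) (b : R) : 0 < b ->
  (Num.truncn (b * ln (n%:R : R)))%:R / ln (n%:R : R) @[n --> \oo] --> b.
Proof.
move=> b0; apply: (@squeeze_cvgr _ _ _ _ (fun n => b - (ln (n%:R : R))^-1) (fun=> b)).
- near=> n.
  have L0 : 0 < ln (n%:R : R).
    by apply: (@lt_le_trans _ _ 1) => //; near: n; exact: near_ln_ge.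
  have := truncn_itv (mulr_ge0 (ltW b0) (ltW L0)).
  rewrite -natr1 => /andP[H1 H2]; rewrite ler_pdivlMr// ler_pdivrMr// H1 andbT.
  by rewrite mulrBl mulVf ?lt0r_neq0// lerBlDr ltW.
- rewrite -[X in _ --> X]subr0; apply: cvgB; [exact: cvg_cst|exact: cvg_inv_ln].
- exact: cvg_cst.
Unshelve. all: by end_near. Qed.

(** By Stirling's bound, the logarithm of the right-hand side is at least
    [L (1 - c rate h - o(1))] with [L = ln n], hence tends to infinity. *)
Lemma near_poisson_pmf_ge (R : realType) (c : R) (m : nat -> nat) (h K : R) :
  0 < c -> 0 < h -> c * rate h < 1 ->
  (m n)%:R * n%:R ^- 2 / ln (n%:R : R) @[n --> \oo] --> c ->
  \forall n \near \oo,
    K <= n%:R * poisson_pmf ((m n)%:R / n%:R ^+ 2)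
                  (Num.truncn (h * c * ln (n%:R : R))).
Proof.
move=> c0 h0 ch m_lim; pose L n : R := ln n%:R.
pose mu n : R := (m n)%:R / n%:R ^+ 2.
pose k n := Num.truncn (h * c * L n).
have hc0 : 0 < h * c by rewrite mulr_gt0.
pose d := 1 - c * rate h; have d0 : 0 < d by rewrite subr_gt0.
pose y := d / (2 * (h * c)); have y0 : 0 < y by rewrite divr_gt0// mulr_gt0.
have limk : (k n)%:R / L n @[n --> \oo] --> h * c by exact: cvg_trunc_ln.
have limr : (mu n / L n) / ((k n)%:R / L n) @[n --> \oo] --> c / (h * c).
  by apply: cvgM => //; apply: cvgV => //; rewrite lt0r_neq0.
have liml : ln ((mu n / L n) / ((k n)%:R / L n)) @[n --> \oo] --> ln (c / (h * c)).
  apply: (continuous_cvg _ _ limr); apply: continuous_ln; exact: divr_gt0.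
(* the term ln k of Stirling's bound is absorbed by the tangent bound
   ln k <= y k - 1 - ln y, where y is small enough to cost only d / 2 *)
have lim : 1 + (k n)%:R / L n * ln ((mu n / L n) / ((k n)%:R / L n)) - mu n / L n
    + (k n)%:R / L n - y * ((k n)%:R / L n) + ln y * (L n)^-1 @[n --> \oo]
    --> 1 + (h * c) * ln (c / (h * c)) - c + h * c - y * (h * c) + ln y * 0.
  apply: cvgD; last by apply: cvgM; [exact: cvg_cst|exact: cvg_inv_ln].
  apply: cvgB; last by apply: cvgM => //; exact: cvg_cst.
  apply: cvgD => //; apply: cvgB => //; apply: cvgD; first exact: cvg_cst.
  exact: cvgM.
have limE : 1 + (h * c) * ln (c / (h * c)) - c + h * c - y * (h * c) + ln y * 0 = d / 2.
  have -> : c / (h * c) = h^-1 by field; rewrite !lt0r_neq0.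
  have -> : y * (h * c) = d / 2 by rewrite /y; field; rewrite !lt0r_neq0.
  by rewrite lnV ?posrE// /d /rate; field.
rewrite {}limE in lim.
have d4 : d / 4 < d / 2 by lra.
near=> n.
have n0 : 0 < n%:R :> R by rewrite ltr0n; near: n; exact: nbhs_infty_ge.
have L0 : 0 < L n.
  by apply: (@lt_le_trans _ _ 1) => //; near: n; exact: near_ln_ge.
have kL : 0 < (k n)%:R / L n by near: n; exact: cvgr_gt limk _ hc0.
have k0 : 0 < (k n)%:R :> R by move: kL; rewrite pmulr_lgt0// invr_gt0.
have mL : 0 < mu n / L n by near: n; exact: cvgr_gt m_lim _ c0.
have m0 : 0 < mu n by move: mL; rewrite pmulr_lgt0// invr_gt0.
have phi : d / 4 <= 1 + (k n)%:R / L n * ln ((mu n / L n) / ((k n)%:R / L n)) - mu n / L n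
    + (k n)%:R / L n - y * ((k n)%:R / L n) + ln y * (L n)^-1.
  by near: n; exact: cvgr_ge lim _ d4.
have eL : `|K| / (d / 4) <= L n by near: n; exact: near_ln_ge.
apply: (@le_trans _ _ (expR (d / 4 * L n))).
  apply: (@le_trans _ _ (d / 4 * L n)).
    by apply: le_trans (ler_norm K) _; rewrite mulrC -ler_pdivrMr// divr_gt0.
  by apply: le_trans (expR_ge1Dx _); rewrite lerDr.
rewrite /poisson_pmf -/(mu n) m0 -/(L n) -/(k n).
have fk : (k n)`!%:R <= expR ((k n)%:R * ln (k n)%:R - (k n)%:R + ln (k n)%:R + 1) :> R.
  by apply: fact_le_stirling; rewrite -(ltr0n R).
have fk0 : 0 < (k n)`!%:R :> R by rewrite ltr0n fact_gt0.
apply: (@le_trans _ _ (expR (L n) * (expR ((k n)%:R * ln (mu n)) *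
    expR (- ((k n)%:R * ln (k n)%:R - (k n)%:R + ln (k n)%:R + 1)) * expR (- mu n)))); last first.
  rewrite lnK// expRM_natl lnK// ler_pM2l// ler_pM2r ?expR_gt0//.
  by rewrite ler_pM2l ?exprn_gt0// expRN lef_pV2// posrE expR_gt0.
rewrite -!expRD ler_expR.
have lk : ln (k n)%:R <= y * (k n)%:R - 1 - ln y.
  have := @ln_le_subr1 R (y * (k n)%:R) (mulr_gt0 y0 k0).
  by rewrite lnM ?posrE//; lra.
have := ler_wpM2r (ltW L0) phi; set F := (X in _ <= X * L n -> _) => HF.
have FL : F * L n = L n + (k n)%:R * (ln (mu n) - ln (k n)%:R) - mu n + (k n)%:R
    - y * (k n)%:R + ln y.
  rewrite /F; have -> : (mu n / L n) / ((k n)%:R / L n) = mu n / (k n)%:R.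
    by field; rewrite !lt0r_neq0.
  rewrite ln_div ?posrE//; field; by rewrite !lt0r_neq0.
rewrite FL in HF; apply: le_trans HF _; lra.
Unshelve. all: by end_near. Qed.

(** * Most throws are spread at a subcritical level *)

(** Once [n q >= 3 / eps ^ 2], where [q] is the Poisson weight of the level, the
    exponent [- r ^ 2 q] is below [- 3 n], which outweighs [4 ^ n <= exp (2 n)] and
    leaves [exp (- n)] against the factor [m = O(n ^ 3)]. *)
Lemma cvg_mean_not_spread (R : realType) (c : R) (m : nat -> nat) (h eps : R) :
  0 < c -> 0 < h -> c * rate h < 1 -> 0 < eps ->
  (forall n, (2 <= n)%N -> (0 < m n)%N) ->
  (m n)%:R * n%:R ^- 2 / ln (n%:R : R) @[n --> \oo] --> c ->
  mean_throw (fun w : {ffun 'I_(m n) -> 'I_n * 'I_n} =>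
    (~~ spread (Num.truncn (h * c * ln (n%:R : R)))
               (Num.truncn (eps * n%:R)).+1 w)%:R : R) @[n --> \oo] --> (0 : R).
Proof.
move=> c0 h0 ch e0 m_gt0 m_lim.
pose B : R := 24 * expR 1 * (c + 1).
apply: (@squeeze_cvgr _ _ _ _ (fun=> 0) (fun n => B * (ln (n%:R : R))^-1)); first last.
- by rewrite -(mulr0 B); apply: cvgM; [exact: cvg_cst|exact: cvg_inv_ln].
- exact: cvg_cst.
have NQ := near_poisson_pmf_ge (3 / eps ^+ 2) c0 h0 ch m_lim.
near=> n.
have n0 : 0 < n%:R :> R by rewrite ltr0n; near: n; exact: nbhs_infty_ge.
have L0 : 0 < ln (n%:R : R).
  by apply: (@lt_le_trans _ _ 1) => //; near: n; exact: near_ln_ge.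
have n2 : (2 <= n)%N by near: n; exact: nbhs_infty_ge.
set k := Num.truncn (h * c * _); set r := (Num.truncn _).+1.
rewrite {1}/mean_throw divr_ge0 ?ler0n ?sumr_ge0//=.
have q0 : 0 <= poisson_pmf ((m n)%:R / n%:R ^+ 2) k :> R by exact: poisson_pmf_ge0.
have nq : 3 / eps ^+ 2 <= n%:R * poisson_pmf ((m n)%:R / n%:R ^+ 2) k :> R.
  by rewrite /k; near: n; exact: NQ.
have mL : (m n)%:R * n%:R ^- 2 / ln n%:R <= c + 1 :> R.
  by near: n; apply: cvgr_le m_lim _ _; rewrite ltrDl.
have Ln : ln n%:R <= n%:R :> R by exact/ltW/ln_sublinear.
have n20 : 0 < n%:R ^+ 2 :> R by rewrite exprn_gt0.
have mn : (m n)%:R <= (c + 1) * n%:R ^+ 3 :> R.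
  move: mL; rewrite ler_pdivrMr// ler_pdivrMr// => /le_trans; apply.
  by rewrite -mulrA ler_pM2l ?addr_gt0// [leRHS]exprS ler_pM2r.
have rn : eps * n%:R <= r%:R :> R by rewrite ltW// truncnS_gt.
have rq : 3 * n%:R <= r%:R ^+ 2 * poisson_pmf ((m n)%:R / n%:R ^+ 2) k :> R.
  apply: (@le_trans _ _ ((eps * n%:R) ^+ 2 * poisson_pmf ((m n)%:R / n%:R ^+ 2) k)).
    move: nq; rewrite ler_pdivrMr ?exprn_gt0// -(ler_pM2r n0) => /le_trans; apply.
    by rewrite le_eqVlt; apply/orP; left; apply/eqP; ring.
  by rewrite ler_wpM2r// lerXn2r ?nnegrE ?mulr_ge0 ?ler0n// ltW.
have e1 : 2 <= expR 1 :> R by have := @expR_ge1Dx R 1; lra.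
have e4 : 4 ^+ n <= expR (n%:R * 2) :> R.
  rewrite expRM_natl lerXn2r ?nnegrE ?expR_ge0//.
  by rewrite -[2 : R]mulr1 expRM_natl; nra.
(* n^4 / 24 is one of the terms of the exponential series at n *)
have en : expR (- n%:R) <= 24 / n%:R ^+ 4 :> R.
  have := @expR_ge1Dxn R n%:R 3 (ltW n0).
  rewrite (_ : 4`!%:R = 24 :> R)// => H.
  rewrite expRN -[leRHS]invrK lef_pV2 ?posrE ?expR_gt0 ?invr_gt0 ?divr_gt0 ?exprn_gt0//.
  by rewrite invf_div; apply: le_trans H; rewrite lerDr.
apply: le_trans (mean_not_spread_le _ _ _ _ (m_gt0 n n2)) _.
apply: (@le_trans _ _ (expR (n%:R * 2) *
    (expR 1 * ((c + 1) * n%:R ^+ 3) * expR (- (3 * n%:R))))).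
  apply: ler_pM => //.
  apply: ler_pM => //; rewrite ?mulr_ge0 ?expR_ge0//.
    by rewrite ler_wpM2l ?expR_ge0.
  by rewrite ler_expR lerN2.
have -> : expR (n%:R * 2) * (expR 1 * ((c + 1) * n%:R ^+ 3) * expR (- (3 * n%:R)))
    = expR 1 * ((c + 1) * n%:R ^+ 3) * expR (- n%:R) :> R.
  by rewrite mulrCA -expRD; congr (_ * expR _); ring.
have c1 : 0 <= expR 1 * ((c + 1) * n%:R ^+ 3) :> R.
  by rewrite !mulr_ge0 ?expR_ge0 ?exprn_ge0// addr_ge0// ltW.
apply: le_trans (ler_wpM2l c1 en) _.
have -> : expR 1 * ((c + 1) * n%:R ^+ 3) * (24 / n%:R ^+ 4) = B / n%:R.
  by rewrite /B; field; rewrite lt0r_neq0.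
rewrite ler_pM2l ?lef_pV2//.
by rewrite /B !mulr_gt0 ?expR_gt0// addr_gt0.
Unshelve. all: by end_near. Qed.

(** Asymptotic equivalence from bounds at every constant on either side of [C]. *)
Lemma eq_1Do1_intro (R : realType) (C : R) (A : nat -> R) (u : nat -> \bar R)
    (v : nat -> R) :
  0 < C -> (forall n, v n = C * (n%:R * ln (n%:R : R))) ->
  (\forall n \near \oo, u n = (A n)%:E) ->
  (forall b, C < b -> \forall n \near \oo, A n <= b * (n%:R * ln (n%:R : R))) ->
  (forall b, 0 < b -> b < C -> \forall n \near \oo, b * (n%:R * ln (n%:R : R)) <= A n) ->
  eq_1Do1 u v.
Proof.
move=> C0 vE uA up lo; exists (fun n => A n / v n - 1); last first.
  near=> n; rewrite (near uA n)//; congr EFin; rewrite addrC subrK mulrC divfK//.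
  rewrite vE mulf_neq0 ?lt0r_neq0// mulr_gt0//.
    by rewrite ltr0n; near: n; exact: nbhs_infty_ge.
  by apply: (@lt_le_trans _ _ 1) => //; near: n; exact: near_ln_ge.
apply/cvgrPdist_le => e e0; pose e' := Num.min e 2^-1.
have e'0 : 0 < e' by rewrite lt_min e0 invr_gt0 ltr0n.
have e'1 : e' < 1 by rewrite gt_min invf_lt1 ?ltr1n ?ltr0n ?orbT.
have e'e : e' <= e by rewrite ge_min lexx.
have /up upn : C < C * (1 + e') by rewrite ltr_pMr// ltrDl.
have lon : \forall n \near \oo, C * (1 - e') * (n%:R * ln (n%:R : R)) <= A n.
  by apply: lo; rewrite ?mulr_gt0 ?subr_gt0// gtr_pMr// gtrBl.
near=> n.
have v0 : 0 < n%:R * ln (n%:R : R).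
  rewrite mulr_gt0//.
    by rewrite ltr0n; near: n; exact: nbhs_infty_ge.
  by apply: (@lt_le_trans _ _ 1) => //; near: n; exact: near_ln_ge.
have U : A n <= C * (1 + e') * (n%:R * ln (n%:R : R)) by near: n.
have V : C * (1 - e') * (n%:R * ln (n%:R : R)) <= A n by near: n.
rewrite sub0r normrN; apply: le_trans e'e; rewrite vE ler_norml.
have Cv0 : 0 < C * (n%:R * ln (n%:R : R)) by exact: mulr_gt0.
apply/andP; split.
  by rewrite lerBrDl ler_pdivlMr// mulrCA mulrA.
by rewrite lerBlDl ler_pdivrMr// mulrCA mulrA.
Unshelve. all: by end_near. Qed.

(** * The two limits *)

Lemma near_mean_max_le (R : realType) (c b h : R) (m : nat -> nat) :
  1 < h -> 1 < c * rate h -> h * c < b ->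
  (m n)%:R * n%:R ^- 2 / ln (n%:R : R) @[n --> \oo] --> c ->
  \forall n \near \oo,
    mean_throw (fun w : {ffun 'I_(m n) -> 'I_n * 'I_n} =>
      (max_assignment (count_matrix w))%:R) <= b * (n%:R * ln (n%:R : R)).
Proof.
move=> h1 ch hb m_lim; have h0 : 0 < h by exact: lt_trans h1.
have a0 : 0 < ln h by exact: ln_gt0.
have E := near_expo_le h0 ch m_lim.
near=> n.
have n0 : 0 < n%:R :> R by rewrite ltr0n; near: n; exact: nbhs_infty_ge.
have n0' : (0 < n)%N by rewrite -(ltr0n R).
have L : (ln h)^-1 / (b - h * c) <= ln (n%:R : R) by near: n; exact: near_ln_ge.
apply: le_trans (mean_max_le _ (h * c * ln n%:R) n0' a0) _.
apply: (@le_trans _ _ (n%:R * (h * c * ln n%:R) + (ln h)^-1 * n%:R)).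
  by rewrite lerD2l ler_pM2l ?invr_gt0//; near: n; exact: E.
move: L; rewrite ler_pdivrMr ?subr_gt0// => L.
have := ler_wpM2l (ltW n0) L; nra.
Unshelve. all: by end_near. Qed.

Lemma near_mean_min_ge (R : realType) (c b h : R) (m : nat -> nat) :
  0 < h < 1 -> 1 < c * rate h -> b < h * c ->
  (m n)%:R * n%:R ^- 2 / ln (n%:R : R) @[n --> \oo] --> c ->
  \forall n \near \oo, b * (n%:R * ln (n%:R : R)) <=
    mean_throw (fun w : {ffun 'I_(m n) -> 'I_n * 'I_n} =>
      (min_assignment (count_matrix w))%:R).
Proof.
move=> h01 ch hb m_lim; have a0 := ln_lt0 h01.
have h0 : 0 < h by case/andP: h01.
have E := near_expo_le h0 ch m_lim.
near=> n.
have n0 : 0 < n%:R :> R by rewrite ltr0n; near: n; exact: nbhs_infty_ge.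
have n0' : (0 < n)%N by rewrite -(ltr0n R).
have L : - (ln h)^-1 / (h * c - b) <= ln (n%:R : R) by near: n; exact: near_ln_ge.
apply: le_trans (mean_min_ge _ (h * c * ln n%:R) n0' a0).
apply: (@le_trans _ _ (n%:R * (h * c * ln n%:R) + (ln h)^-1 * n%:R)); last first.
  by rewrite lerD2l ler_nM2l ?invr_lt0//; near: n; exact: E.
move: L; rewrite ler_pdivrMr ?subr_gt0// => L.
have := ler_wpM2l (ltW n0) L; nra.
Unshelve. all: by end_near. Qed.

Lemma near_mean_max_ge (R : realType) (c b h : R) (m : nat -> nat) :
  0 < c -> 0 < h -> c * rate h < 1 -> 0 < b -> b < h * c ->
  (forall n, (2 <= n)%N -> (0 < m n)%N) ->
  (m n)%:R * n%:R ^- 2 / ln (n%:R : R) @[n --> \oo] --> c ->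
  \forall n \near \oo, b * (n%:R * ln (n%:R : R)) <=
    mean_throw (fun w : {ffun 'I_(m n) -> 'I_n * 'I_n} =>
      (max_assignment (count_matrix w))%:R).
Proof.
move=> c0 h0 ch b0 hb m_gt0 m_lim; have hc0 : 0 < h * c by exact: mulr_gt0.
pose eps : R := (h * c - b) / (2 * (h * c)).
have eps0 : 0 < eps by rewrite divr_gt0 ?subr_gt0// mulr_gt0.
(* this eps makes (1 - eps) h c the midpoint of b and h c *)
have eps1 : eps < 1 by rewrite ltr_pdivrMr ?mulr_gt0//; lra.
have bad := cvg_mean_not_spread c0 h0 ch eps0 m_gt0 m_lim.
set d := (fun n : nat => _) in bad.
pose k n := Num.truncn (h * c * ln (n%:R : R)).
have lim : (1 - eps) * ((k n)%:R / ln (n%:R : R)) * (1 - d n) @[n --> \oo] -->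
    (1 - eps) * (h * c) * (1 - 0).
  apply: cvgM; last by apply: cvgB => //; exact: cvg_cst.
  by apply: cvgM; [exact: cvg_cst|exact: cvg_trunc_ln].
have blim : b < (1 - eps) * (h * c) * (1 - 0).
  rewrite subr0 mulr1 (_ : (1 - eps) * (h * c) = (h * c + b) / 2); first by lra.
  by rewrite /eps; field; rewrite !lt0r_neq0.
near=> n.
have n0 : 0 < n%:R :> R by rewrite ltr0n; near: n; exact: nbhs_infty_ge.
have n0' : (0 < n)%N by rewrite -(ltr0n R).
have L0 : 0 < ln (n%:R : R).
  by apply: (@lt_le_trans _ _ 1) => //; near: n; exact: near_ln_ge.
have B : b <= (1 - eps) * ((k n)%:R / ln (n%:R : R)) * (1 - d n).
  by near: n; exact: cvgr_ge lim _ blim.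
have d1 : d n <= 1 by near: n; exact: cvgr_le bad _ ltr01.
have en : 0 <= eps * n%:R by rewrite mulr_ge0 ?ltW.
have un : (Num.truncn (eps * n%:R))%:R <= eps * n%:R by rewrite truncn_le.
have un' : (Num.truncn (eps * n%:R) <= n)%N.
  by rewrite -(ler_nat R); apply: le_trans un _; rewrite ger_pMl// ltW.
apply: le_trans (mean_max_ge _ _ (k n) n0' un').
rewrite -/(d n).
have := ler_wpM2r (ltW (mulr_gt0 n0 L0)) B => /le_trans; apply.
apply: (@le_trans _ _ ((1 - eps) * n%:R * (k n)%:R * (1 - d n))).
  by rewrite le_eqVlt; apply/orP; left; apply/eqP; field; rewrite lt0r_neq0.
rewrite ler_wpM2r ?subr_ge0// ler_wpM2r//.
by rewrite mulrBl mul1r lerD2l lerN2.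
Unshelve. all: by end_near. Qed.

(** The exceptional rows are charged to a level [g] with [c rate g = 2]; any
    supercritical level above the mean would do, since these rows are an
    arbitrarily small fraction of all rows. *)
Lemma near_mean_min_le (R : realType) (c b h : R) (m : nat -> nat) :
  0 < c -> 0 < h -> c * rate h < 1 -> h * c < b ->
  (forall n, (2 <= n)%N -> (0 < m n)%N) ->
  (m n)%:R * n%:R ^- 2 / ln (n%:R : R) @[n --> \oo] --> c ->
  \forall n \near \oo,
    mean_throw (fun w : {ffun 'I_(m n) -> 'I_n * 'I_n} =>
      (min_assignment (count_matrix w))%:R) <= b * (n%:R * ln (n%:R : R)).
Proof.
move=> c0 h0 ch hb m_gt0 m_lim; have hc0 : 0 < h * c by exact: mulr_gt0.
have [|g g1 gE] := @rate_root_gt1 R (2 / c); first by rewrite divr_gt0.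
have g0 : 0 < g by exact: lt_trans g1.
have cg : 1 < c * rate g by rewrite gE mulrC divfK ?lt0r_neq0// ltr1n.
have gc0 : 0 < g * c by exact: mulr_gt0.
have a0 : 0 < ln g by exact: ln_gt0.
have E := near_expo_le g0 cg m_lim.
pose eps : R := (b - h * c) / (2 * (g * c)).
have eps0 : 0 < eps by rewrite divr_gt0 ?subr_gt0// mulr_gt0.
have bad := cvg_mean_not_spread c0 h0 ch eps0 m_gt0 m_lim.
set d := (fun n : nat => _) in bad.
pose k n := Num.truncn (h * c * ln (n%:R : R)).
have lim : (k n)%:R / ln (n%:R : R) + eps * (g * c) + g * c * d n
    + (ln g)^-1 * (ln (n%:R : R))^-1 @[n --> \oo] -->
    h * c + eps * (g * c) + g * c * 0 + (ln g)^-1 * 0.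
  apply: cvgD; last by apply: cvgM; [exact: cvg_cst|exact: cvg_inv_ln].
  apply: cvgD; last by apply: cvgM => //; exact: cvg_cst.
  by apply: cvgD; [exact: cvg_trunc_ln|exact: cvg_cst].
have blim : h * c + eps * (g * c) + g * c * 0 + (ln g)^-1 * 0 < b.
  rewrite !mulr0 !addr0 (_ : eps * (g * c) = (b - h * c) / 2); first by lra.
  by rewrite /eps; field; rewrite !lt0r_neq0.
near=> n.
have n0 : 0 < n%:R :> R by rewrite ltr0n; near: n; exact: nbhs_infty_ge.
have n0' : (0 < n)%N by rewrite -(ltr0n R).
have L0 : 0 < ln (n%:R : R).
  by apply: (@lt_le_trans _ _ 1) => //; near: n; exact: near_ln_ge.
have B : (k n)%:R / ln (n%:R : R) + eps * (g * c) + g * c * d n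
    + (ln g)^-1 * (ln (n%:R : R))^-1 <= b.
  by near: n; exact: cvgr_le lim _ blim.
have t0 : 0 <= g * c * ln (n%:R : R) by rewrite mulr_ge0 ?ltW.
have en : 0 <= eps * n%:R by rewrite mulr_ge0 ?ltW.
have un : (Num.truncn (eps * n%:R))%:R <= eps * n%:R by rewrite truncn_le.
apply: le_trans (mean_min_le _ (k n) (Num.truncn (eps * n%:R)) n0' a0 t0) _.
rewrite -/(d n).
have := ler_wpM2r (ltW (mulr_gt0 n0 L0)) B; apply: le_trans.
have En : n%:R ^+ 2 * expR ((m n)%:R / n%:R ^+ 2 * (expR (ln g) - 1)
    - ln g * (g * c * ln n%:R)) <= n%:R :> R by near: n; exact: E.
apply: (@le_trans _ _ (n%:R * (k n)%:R + eps * n%:R * (g * c * ln n%:R) +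
  n%:R * (g * c * ln n%:R) * d n + (ln g)^-1 * n%:R)).
  apply: lerD; last by rewrite ler_pM2l ?invr_gt0.
  by rewrite lerD2r lerD2l ler_wpM2r.
rewrite le_eqVlt; apply/orP; left; apply/eqP.
by field; rewrite !lt0r_neq0.
Unshelve. all: by end_near. Qed.

Theorem theorem2 (R : realType) (c : R) (m : nat -> nat)
    (d : nat -> measure_display) (T : forall n : nat, measurableType (d n))
    (P : forall n : nat, probability (T n) R)
    (X : forall n : nat, T n -> 'M[nat]_n)
    (c_gt0 : 0 < c)
    (m_gt0 : forall n : nat, (2 <= n)%N -> (0 < m n)%N)
    (X_law : forall n : nat, (2 <= n)%N -> multinomial_matrix (P n) (m n) (X n))
    (m_lim : (m n)%:R * n%:R ^- 2 / ln (n%:R : R) @[n --> \oo] --> c) :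
  (exists2 H : R,
     unique (fun h : R => 1 < h /\ h * ln h - (h - 1) = 1 / c) H &
     eq_1Do1 (fun n => 'E_(P n)[fun w => (max_assignment (X n w))%:R])%E
             (fun n => c * H * n%:R * ln n%:R)) /\
  (1 < c ->
   exists2 H : R,
     unique (fun h : R => (0 < h /\ h < 1) /\ h * ln h - (h - 1) = 1 / c) H &
     eq_1Do1 (fun n => 'E_(P n)[fun w => (min_assignment (X n w))%:R])%E
             (fun n => c * H * n%:R * ln n%:R)).
Proof.
have law (g : forall n, 'M[nat]_n -> nat) : \forall n \near \oo,
    ('E_(P n)[fun w => (g n (X n w))%:R] =
     (mean_throw (fun w : {ffun 'I_(m n) -> 'I_n * 'I_n} =>
        (g n (count_matrix w))%:R))%:E)%E.
  near=> n; have n2 : (2 <= n)%N by near: n; exact: nbhs_infty_ge.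
  apply: (expectation_multinomial (g := fun A => (g n A)%:R)) (X_law n n2) => //.
  exact: ltn_trans n2.
have vE H n : c * H * n%:R * ln n%:R = c * H * (n%:R * ln n%:R) :> R by rewrite !mulrA.
split=> [|c1].
  have [|H H1 HE] := @rate_root_gt1 R (1 / c); first exact: divr_gt0.
  have cH : c * rate H = 1 by rewrite HE mulrC divfK// lt0r_neq0.
  have cH0 : 0 < c * H by rewrite mulr_gt0// (lt_trans ltr01).
  exists H.
    split=> // h [h1 hE]; apply/eqP; case: ltgtP => // lt.
      by have := rate_incr (ltW H1) lt; rewrite HE /rate hE ltxx.
    by have := rate_incr (ltW h1) lt; rewrite HE /rate hE ltxx.
  apply: (eq_1Do1_intro cH0 (vE H) (law max_assignment)) => b.
    rewrite mulrC -ltr_pdivlMr// => Hb.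
    have := midf_lt Hb; set h := (_ + _) / _ => -[hH hb].
    apply: (@near_mean_max_le R c b h) => //.
    - exact: lt_trans hH.
    - by rewrite -cH ltr_pM2l// rate_incr// ltW.
    - by rewrite -ltr_pdivlMr.
  move=> b0; rewrite mulrC -ltr_pdivrMr// => bH.
  have /midf_lt[] : Num.max 1 (b / c) < H by rewrite gt_max H1.
  set h := (_ + _) / _; rewrite gt_max => /andP[h1 bh] hH.
  apply: (@near_mean_max_ge R c b h) => //.
  - exact: lt_trans h1.
  - by rewrite -cH ltr_pM2l// rate_incr// ltW.
  - by rewrite -ltr_pdivrMr.
have [||H /andP[H0 H1] HE] := @rate_root_lt1 R (1 / c).
- exact: divr_gt0.
- by rewrite ltr_pdivrMr// mul1r.
have cH : c * rate H = 1 by rewrite HE mulrC divfK// lt0r_neq0.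
have cH0 : 0 < c * H by rewrite mulr_gt0.
exists H.
  split=> // h [[h0 h1] hE]; apply/eqP; case: ltgtP => // lt.
    by have := rate_decr H0 lt (ltW h1); rewrite HE /rate hE ltxx.
  by have := rate_decr h0 lt (ltW H1); rewrite HE /rate hE ltxx.
apply: (eq_1Do1_intro cH0 (vE H) (law min_assignment)) => b.
  rewrite mulrC -ltr_pdivlMr// => Hb.
  have /midf_lt[] : H < Num.min 1 (b / c) by rewrite lt_min H1.
  set h := (_ + _) / _; rewrite lt_min => Hh /andP[h1 hb].
  apply: (@near_mean_min_le R c b h) => //.
  - exact: lt_trans Hh.
  - by rewrite -cH ltr_pM2l// rate_decr// ltW.
  - by rewrite -ltr_pdivlMr.
move=> b0; rewrite mulrC -ltr_pdivrMr// => bH.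
have := midf_lt bH; set h := (_ + _) / _ => -[bh hH].
have h0 : 0 < h by apply: lt_trans bh; exact: divr_gt0.
apply: (@near_mean_min_ge R c b h) => //.
- by rewrite h0 (lt_trans hH).
- by rewrite -cH ltr_pM2l// rate_decr// ltW.
- by rewrite -ltr_pdivrMr.
Unshelve. all: by end_near. Qed.
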